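(* Let $f:[0,1]\to\mathbb{R}^d$ be the self-affine function described in the context, and assume that $c_i=1/m$ for $i=1,\dots,m$ and $\boldsymbol\varepsilon=(0,0,\dots,0)$. Then $\alpha_f(t)=\tilde\alpha_f(t)$ for every $t\in(0,1)$.
   Context: Setting. Fix integers $d\geq 1$ and $m\geq 2$, let $\mathbf{a}=(0,0,\dots,0)$ and $\mathbf{b}=(1,0,\dots,0)$ in $\mathbb{R}^d$, and fix $\boldsymbol\varepsilon=(\varepsilon_1,\dots,\varepsilon_m)\in\{0,1\}^m$ (the signature). Let $S_1,\dots,S_m$ be contractive similitudes of $\mathbb{R}^d$ with ratios $\lambda_i:=\mathrm{Lip}(S_i)\in[0,1)$ (if $m\geq 3$ one or more $S_i$ may be constant, so $\lambda_i=0$; if $m=2$ all $\lambda_i>0$), satisfying $S_1((1-\varepsilon_1)\mathbf{a}+\varepsilon_1\mathbf{b})=\mathbf{a}$, $S_m(\varepsilon_m\mathbf{a}+(1-\varepsilon_m)\mathbf{b})=\mathbf{b}$, and $S_{i-1}(\varepsilon_{i-1}\mathbf{a}+(1-\varepsilon_{i-1})\mathbf{b})=S_i((1-\varepsilon_i)\mathbf{a}+\varepsilon_i\mathbf{b})$ for $i=2,\dots,m$. Let $c_1,\dots,c_m>0$ with $\sum_{i=1}^m c_i=1$, put $\sigma_i:=\sum_{j=1}^{i-1}c_j+\varepsilon_ic_i$, $\phi_i(t):=(-1)^{\varepsilon_i}c_it+\sigma_i$, and $I_i:=\phi_i([0,1])$. Then $f:[0,1]\to\mathbb{R}^d$ is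 the unique continuous function with $f(t)=S_i(f(\phi_i^{-1}(t)))$ for $t\in I_i$, $i=1,\dots,m$. It is assumed throughout that $(\lambda_1,\dots,\lambda_m)\neq(c_1,\dots,c_m)$. Hölder exponents. For $\alpha>0$ and $t_0\in(0,1)$, write $f\in C^\alpha(t_0)$ if there are a constant $C$ and a $d$-tuple $P=(P_1,\dots,P_d)$ of real polynomials, each of degree less than $\alpha$, such that $|f(t)-P(t-t_0)|\leq C|t-t_0|^\alpha$ for all $t\in(0,1)$. Write $f\in\tilde C^\alpha(t_0)$ if there is a constant $C$ such that $|f(t)-f(t_0)|\leq C|t-t_0|^\alpha$ for all $t\in(0,1)$. The pointwise Hölder exponent is $\alpha_f(t):=\sup\{\alpha>0:f\in C^\alpha(t)\}$, and the nondirectional Hölder exponent is $\tilde\alpha_f(t):=\sup\{\alpha>0:f\in\tilde C^\alpha(t)\}$ (both may be $\infty$). *)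

(* Defs.v *)
From HB Require Import structures.
From mathcomp Require Export all_boot all_order all_algebra.
From mathcomp Require Export all_classical all_reals all_analysis.

Set Implicit Arguments.
Unset Strict Implicit.
Unset Printing Implicit Defensive.

Import Order.TTheory GRing.Theory Num.Theory.
Export numFieldNormedType.Exports.

Local Open Scope classical_set_scope.
Local Open Scope ring_scope.

(* The library norm on ['rV[R]_d] is the sup norm; similitudes are taken with
   respect to the Euclidean one. *)
Definition enorm (R : realType) (d : nat) (x : 'rV[R]_d) : R :=
  Num.sqrt (\sum_(j < d) x 0 j ^+ 2).

(* For [0 < d] the ratio [r] is determined by [S]: it is the Lipschitz constant
   of [S].  Constant maps have ratio [0]. *)
Definition contractive_similitude (R : realType) (d : nat)
    (S : 'rV[R]_d -> 'rV[R]_d) (r : R) : Prop :=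
  0 <= r < 1 /\ forall x y, enorm (S x - S y) = r * enorm (x - y).

Definition pta (R : realType) (d : nat) : 'rV[R]_d := 0.
Definition ptb (R : realType) (d : nat) : 'rV[R]_d :=
  \row_(j < d) (val j == 0)%N%:R.

(* Indices [1, ..., m] are shifted to [0, ..., m - 1], and a signature is a
   family of booleans, with [true] standing for [1]. *)
Section SelfAffine.
Variables (R : realType) (d m : nat).
Variables (eps : 'I_m -> bool) (lam c : 'I_m -> R).
Variable S : 'I_m -> 'rV[R]_d -> 'rV[R]_d.

Definition first_pt (i : 'I_m) : 'rV[R]_d :=
  (1 - (eps i)%:R) *: pta R d + (eps i)%:R *: ptb R d.
Definition last_pt (i : 'I_m) : 'rV[R]_d :=
  (eps i)%:R *: pta R d + (1 - (eps i)%:R) *: ptb R d.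

Definition sigma (i : 'I_m) : R :=
  \sum_(j < m | (j < i)%N) c j + (eps i)%:R * c i.

Definition phi (i : 'I_m) (t : R) : R := (-1) ^+ eps i * c i * t + sigma i.

Definition phi_inv (i : 'I_m) (t : R) : R :=
  (t - sigma i) / ((-1) ^+ eps i * c i).

Lemma phiK (i : 'I_m) : 0 < c i -> cancel (phi i) (phi_inv i).
Proof.
move=> ci t; rewrite /phi_inv /phi addrK mulrC mulKf //.
by rewrite mulf_neq0 ?signr_eq0 ?gt_eqF.
Qed.

Lemma phi_invK (i : 'I_m) : 0 < c i -> cancel (phi_inv i) (phi i).
Proof.
move=> ci t; rewrite /phi_inv /phi mulrC divfK ?subrK //.
by rewrite mulf_neq0 ?signr_eq0 ?gt_eqF.
Qed.

Definition I_ (i : 'I_m) : set R := phi i @` `[0, 1].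

Record self_affine_system : Prop := {
  sas_dim : (1 <= d)%N;
  sas_size : (2 <= m)%N;
  sas_sim : forall i, contractive_similitude (S i) (lam i);
  sas_lam2 : m = 2%N -> forall i, 0 < lam i;
  sas_first : forall i, val i = 0%N -> S i (first_pt i) = pta R d;
  sas_last : forall i, (val i).+1 = m -> S i (last_pt i) = ptb R d;
  sas_link : forall i j, val j = (val i).+1 ->
    S i (last_pt i) = S j (first_pt j);
  sas_c_gt0 : forall i, 0 < c i;
  sas_c_sum : \sum_(i < m) c i = 1;
  sas_neq : ~ (lam =1 c)
}.

(* Only the values of [f] on [[0, 1]] are constrained (and used). *)
Definition self_affine_function (f : R -> 'rV[R]_d) : Prop :=
  {within `[0, 1], continuous f} /\
  forall i t, I_ i t -> f t = S i (f (phi_inv i t)).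

End SelfAffine.

Section Hoelder.
Variables (R : realType) (d : nat) (f : R -> 'rV[R]_d).

Definition poly_row (P : 'I_d -> {poly R}) (x : R) : 'rV[R]_d :=
  \row_(j < d) (P j).[x].

(* The degree of [p] is [(size p).-1]; the zero polynomial counts as having
   degree [0], which is harmless as [0 < alpha] below. *)
Definition in_C (alpha t0 : R) : Prop :=
  exists (C : R) (P : 'I_d -> {poly R}),
    (forall j, (size (P j)).-1%:R < alpha) /\
    forall t, 0 < t < 1 ->
      enorm (f t - poly_row P (t - t0)) <= C * `|t - t0| `^ alpha.

Definition in_Ctilde (alpha t0 : R) : Prop :=
  exists C : R, forall t, 0 < t < 1 ->
    enorm (f t - f t0) <= C * `|t - t0| `^ alpha.

Definition hoelder_exponent (t : R) : \bar R :=
  ereal_sup (EFin @` [set alpha | 0 < alpha /\ in_C alpha t]).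

Definition nondir_hoelder_exponent (t : R) : \bar R :=
  ereal_sup (EFin @` [set alpha | 0 < alpha /\ in_Ctilde alpha t]).

End Hoelder.

(* Main.v *)
(* For equal [c_i] and zero signature, [f] on the [m]-adic interval of order [n]
   containing [t0] is a similar copy of [f] on [[0, 1]].  If an expansion of [f]
   at [t0] of order [alpha] had a nonzero term of least degree [k >= 1], blowing
   up these intervals (along a subsequence for which the relative position of
   [t0] converges to some [x]) would give, for all [s], [s'] in [[0, 1]],
   [|f s - f s'| = const * |(s - x)^k - (s' - x)^k|].  Since [f] contracts by
   [lambda_i] on the [i]-th piece, so does [(s - x)^k]; this is impossible for
   [k >= 2], and for [k = 1] it forces [lambda_i = 1 / m = c_i].  Hence the
   polynomial of an expansion is always constant. *)
From mathcomp Require Import ring lra.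
Require Import Defs.

Set Implicit Arguments.
Unset Strict Implicit.
Unset Printing Implicit Defensive.

Import Order.TTheory GRing.Theory Num.Theory.
Local Open Scope classical_set_scope.
Local Open Scope ring_scope.

(** * The Euclidean norm and similitudes *)

Lemma sqr_enorm (R : realType) (d : nat) (x : 'rV[R]_d) :
  enorm x ^+ 2 = \sum_(j < d) x 0 j ^+ 2.
Proof. by rewrite sqr_sqrtr // sumr_ge0 // => j _; exact: sqr_ge0. Qed.

Lemma enorm_ge0 (R : realType) (d : nat) (x : 'rV[R]_d) : 0 <= enorm x.
Proof. exact: sqrtr_ge0. Qed.

Lemma norm_coord_le_enorm (R : realType) (d : nat) (x : 'rV[R]_d) (j : 'I_d) :
  `|x 0 j| <= enorm x.
Proof.
rewrite -(ler_pXn2r (n := 2)) ?nnegrE ?enorm_ge0 // sqr_enorm.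
rewrite real_normK ?num_real // (bigD1 j) //= lerDl sumr_ge0 // => i _.
exact: sqr_ge0.
Qed.

Lemma enorm0_eq0 (R : realType) (d : nat) (x : 'rV[R]_d) :
  enorm x = 0 -> x = 0.
Proof.
move=> x0; apply/rowP => j; rewrite mxE; apply/eqP; rewrite -normr_le0 -x0.
exact: norm_coord_le_enorm.
Qed.

Lemma enorm_ptb (R : realType) (d : nat) : (0 < d)%N -> enorm (ptb R d) = 1.
Proof.
case: d => // d _; rewrite /enorm big_ord_recl big1 => [|i _].
  by rewrite mxE expr1n addr0 sqrtr1.
by rewrite mxE expr0n.
Qed.

Lemma similitude_fixpoint_unique (R : realType) (d : nat)
    (S : 'rV[R]_d -> 'rV[R]_d) (r : R) (x y : 'rV[R]_d) :
  contractive_similitude S r -> S x = x -> S y = y -> x = y.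
Proof.
move=> [/andP[_ r1] Sr] Sx Sy; apply/eqP; rewrite -subr_eq0; apply/eqP.
apply: enorm0_eq0; have := Sr x y; rewrite Sx Sy => e.
have : (1 - r) * enorm (x - y) = 0 by rewrite mulrBl mul1r -e subrr.
by move/eqP; rewrite mulf_eq0 subr_eq0 gt_eqF //= => /eqP.
Qed.

(** * Polynomial identities and rigidity of shifted powers *)

Lemma poly_eq_on_unit_interval (R : realType) (p q : {poly R}) :
  (forall s, 0 <= s <= 1 -> p.[s] = q.[s]) -> p = q.
Proof.
move=> pq; apply/eqP; rewrite -subr_eq0; apply/eqP.
(* Reciprocals of positive integers supply as many distinct roots in the unit interval as the size
   of [p - q]. *)
apply: (@roots_geq_poly_eq0 _ _ [seq n.+1%:R^-1 | n <- iota 0 (size (p - q))]).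
- apply/allP => _ /mapP[n _ ->]; rewrite rootE hornerD hornerN pq ?subrr //.
  by rewrite invr_ge0 ler0n invf_le1 ?ler1n ?ltr0n.
- rewrite map_inj_uniq ?iota_uniq // => a b /invr_inj /eqP.
  by rewrite eqr_nat => /eqP[].
- by rewrite size_map size_iota.
Qed.

(* If [k > 1], the derivative of the right-hand side vanishes at [x], so [x] is
   a fixed point of every [s |-> (i + s) / m], which is absurd as [1 < m]. *)
Lemma power_similitude_ratio (R : realType) (m k : nat) (lam : 'I_m -> R)
    (x : R) :
  (1 < m)%N -> (0 < k)%N -> (forall i, 0 <= lam i) -> 0 <= x <= 1 ->
  (forall (i : 'I_m) (s s' : R), 0 <= s <= 1 -> 0 <= s' <= 1 ->
    (((i%:R + s) / m%:R - x) ^+ k - ((i%:R + s') / m%:R - x) ^+ k) ^+ 2 =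
    lam i ^+ 2 * ((s - x) ^+ k - (s' - x) ^+ k) ^+ 2) ->
  forall i, lam i = m%:R^-1.
Proof.
move=> m1 k0 lam0 x01 h.
have m0 : (0 : R) < m%:R by rewrite ltr0n (ltn_trans _ m1).
have [k1|k1] := leqP k 1.
  have {}k1 : k = 1%N by apply/eqP; rewrite eqn_leq k1.
  (* For [k = 1] the shift [x] cancels, and the increment between 0 and 1 gives the ratio. *)
  move=> i; have := h i 1 0; rewrite k1 !expr1 !lexx !ler01.
  move=> /(_ isT isT) e; apply/eqP; rewrite -(eqrXn2 (n := 2)) ?invr_ge0 //.
  apply/eqP; rewrite -[LHS]mulr1 -(expr1n R 2) -[X in _ * X ^+ _](_ : 1 - x - (0 - x) = 1).
    by rewrite -e; congr (_ ^+ 2); field; rewrite gt_eqF.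
  by ring.
have key (i : 'I_m) : (i%:R + x) / m%:R = x.
  (* Putting [s' = x] leaves a pure power on the right. Polynomials over a field form an integral
     domain, so equal squares give [p = q] or [p = - q]. *)
  pose p := (m%:R^-1 *: 'X + (i%:R / m%:R - x)%:P) ^+ k
     - (((i%:R + x) / m%:R - x) ^+ k)%:P.
  pose q := lam i *: ('X - x%:P) ^+ k.
  have /eqP : p ^+ 2 = q ^+ 2.
    apply: poly_eq_on_unit_interval => s s01.
    have := h i s x s01 x01; rewrite subrr expr0n gtn_eqF // subr0 -exprMn.
    rewrite /p /q !hornerE => <-.
    by congr ((_ ^+ _ - _) ^+ _) => /=; ring.
  rewrite eqf_sqr => pq.
  have q'0 : q^`().[x] = 0.
    rewrite /q derivZ deriv_exp !hornerE hornerMn hornerM horner_exp !hornerE subrr.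
    by rewrite expr0n -subn1 subn_eq0 leqNgt k1 mulr0 mul0rn mulr0.
  have : p^`().[x] = 0.
    by case/orP: pq => /eqP ->; rewrite ?derivN ?hornerN q'0 ?oppr0.
  (* The derivative of [p] at [x] is [k / m] times the power [k - 1] of [(i + x) / m - x], so that
     base vanishes. *)
  rewrite /p derivB derivC subr0 deriv_exp derivD derivZ derivX derivC addr0.
  rewrite hornerMn hornerM horner_exp !hornerE => /eqP.
  rewrite mulrn_eq0 gtn_eqF //= mulf_eq0 invr_eq0 gt_eqF //= expf_eq0.
  move=> /andP[_ /eqP e]; apply/eqP; rewrite -subr_eq0 -e; apply/eqP; ring.
have := key (Ordinal m1); rewrite -[in RHS](key (Ordinal (ltnW m1))) /=.
move/(mulIf (invr_neq0 (lt0r_neq0 m0)))/addIr/eqP.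
by rewrite oner_eq0.
Qed.

(** * Subdivision into m-adic intervals *)

Lemma branch_unit_interval (R : realType) (m : nat) (i : 'I_m) (s : R) :
  0 <= s <= 1 -> 0 <= (i%:R + s) / m%:R <= 1.
Proof.
move=> /andP[s0 s1]; apply/andP; split; first by rewrite divr_ge0 ?addr_ge0.
rewrite ler_pdivrMr ?ltr0n ?(leq_trans _ (ltn_ord i)) // mul1r.
by rewrite (le_trans (lerD (lexx _) s1)) // natr1 ler_nat.
Qed.

Lemma unit_interval_digit (R : realType) (m : nat) (s : R) :
  (0 < m)%N -> 0 <= s <= 1 ->
  exists (r : 'I_m) (s' : R), 0 <= s' <= 1 /\ s = (r%:R + s') / m%:R.
Proof.
case: m => // m _ /andP[s0 s1].
have m0 : (m.+1%:R : R) != 0 by rewrite pnatr_eq0.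
(* For [s = 1] truncation would give an out-of-range digit, so the last piece is used. *)
have [->|sn1] := eqVneq s 1.
  exists ord_max, 1; rewrite lexx ler01; split => //=.
  by rewrite -natr1 divff // natr1.
have sm0 : 0 <= s * m.+1%:R by rewrite mulr_ge0.
have rm : (Num.truncn (s * m.+1%:R) < m.+1)%N.
  by rewrite truncn_lt_nat // gtr_pMl ?ltr0n // lt_neqAle sn1.
exists (Ordinal rm), (s * m.+1%:R - (Num.truncn (s * m.+1%:R))%:R); split => /=.
  have /andP[a b] := truncn_itv sm0.
  by rewrite subr_ge0 a lerBlDl natr1 ltW.
by rewrite addrC subrK mulfK.
Qed.

(** Induction on [n], subdividing an m-adic interval around [t0]: [sL.1] is the relative position of
    [t0] in it, and [sL.2] is the product of the ratios met so far. *)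
Lemma zoom_similarity (R : realType) (d m : nat) (lam : 'I_m -> R)
    (f : R -> 'rV[R]_d) :
  (0 < m)%N ->
  (forall (i : 'I_m) (s s' : R), 0 <= s <= 1 -> 0 <= s' <= 1 ->
    enorm (f ((i%:R + s) / m%:R) - f ((i%:R + s') / m%:R)) =
    lam i * enorm (f s - f s')) ->
  forall (t0 : R) (n : nat), 0 <= t0 <= 1 ->
  exists sL : R * R, 0 <= sL.1 <= 1 /\
    forall s s', 0 <= s <= 1 -> 0 <= s' <= 1 ->
      enorm (f (t0 + m%:R^-1 ^+ n * (s - sL.1))
             - f (t0 + m%:R^-1 ^+ n * (s' - sL.1))) = sL.2 * enorm (f s - f s').
Proof.
move=> m0 h t0 n t01; elim: n => [|n [[s0 L] /= [s01 IH]]].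
  exists (t0, 1) => /=; split=> // s s' _ _.
  by rewrite expr0 !mul1r !(addrC t0) !subrK.
have [r [s1 [s101 e]]] := unit_interval_digit m0 s01.
exists (s1, L * lam r) => /=; split=> // s s' s_01 s'_01.
rewrite -mulrA -h // -IH ?branch_unit_interval // e.
by congr (enorm (f _ - f _)); rewrite exprSr; ring.
Qed.

(** * Blow-up of a polynomial expansion *)

(** Write [p.[y] = p.[0] + y ^+ k * q.[y]]. After rescaling, the last term gives the limit; since
    [t] stays within [rho n] of [t0], the error is of order [rho n] to the power [alpha - k], which
    tends to 0. *)
Lemma rescaled_increment_cvg (R : realType) (g : R -> R) (p : {poly R})
    (alpha C t0 x s : R) (k : nat) (rho s_ : nat -> R) :
  0 < t0 < 1 -> (0 < k)%N -> k%:R < alpha ->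
  (forall t, 0 < t < 1 -> `|g t - p.[t - t0]| <= C * `|t - t0| `^ alpha) ->
  (forall i, (0 < i < k)%N -> p`_i = 0) ->
  (forall n, 0 < rho n) -> rho @ \oo --> 0 ->
  (forall n, `|s - s_ n| <= 1) -> s_ @ \oo --> x ->
  (g (t0 + rho n * (s - s_ n)) - g t0) / rho n ^+ k @[n --> \oo]
    --> p`_k * (s - x) ^+ k.
Proof.
move=> t01 k0 ka gp p0 rho0 rhoc s1 sc.
have /andP[t0_gt0 t0_lt1] := t01.
have a0 : 0 < alpha by apply: le_lt_trans ka.
have gt0 : g t0 = p.[0].
  apply/eqP; rewrite -subr_eq0 -normr_le0; have := gp t0 t01.
  by rewrite subrr normr0 powR0 ?gt_eqF // mulr0.
pose q := drop_poly k p.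
have pE y : p.[y] = p.[0] + y ^+ k * q.[y].
  rewrite -[p in LHS](poly_take_drop k) hornerD hornerM hornerXn mulrC.
  congr (_ + _).
  have -> : take_poly k p = (p`_0)%:P.
    apply/polyP => i; rewrite coef_take_poly coefC.
    case: eqVneq => [->|i0]; first by rewrite k0.
    by case: ifP => // ik; rewrite p0 // ik lt0n i0.
  by rewrite hornerC horner_coef0.
have sxc : s - s_ n @[n --> \oo] --> s - x.
  by apply: cvgB => //; exact: cvg_cst.
have hc : rho n * (s - s_ n) @[n --> \oo] --> 0.
  by rewrite -(mul0r (s - x)); apply: cvgM.
have tc : t0 + rho n * (s - s_ n) @[n --> \oo] --> t0.
  by rewrite -[X in _ --> X]addr0; apply: cvgD => //; exact: cvg_cst.
have main : (s - s_ n) ^+ k * q.[rho n * (s - s_ n)] @[n --> \oo]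
    --> (s - x) ^+ k * q.[0].
  apply: cvgM.
    exact: (cvg_comp _ _ sxc (@exprn_continuous R k _)).
  exact: (cvg_comp _ _ hc (@continuous_horner R q _)).
have rest : (g (t0 + rho n * (s - s_ n)) - p.[rho n * (s - s_ n)]) / rho n ^+ k
    @[n --> \oo] --> 0.
  apply/norm_cvg0P.
  have up : `|C| * rho n `^ (alpha - k%:R) @[n --> \oo] --> 0.
    rewrite -(mulr0 `|C|); apply: cvgM; first exact: cvg_cst.
    have ak : 0 < alpha - k%:R by rewrite subr_gt0.
    by have /cvg_at_rightP := powR_cvg0 ak; apply.
  apply: squeeze_cvgr; [|exact: cvg_cst|exact: up].
  near=> n.
  rewrite normr_ge0 /= normrM normfV (ger0_norm (exprn_ge0 k (ltW (rho0 n)))).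
  rewrite ler_pdivrMr ?exprn_gt0 // -mulrA -(powR_mulrn _ (ltW (rho0 n))) -powRD; last first.
    by rewrite (lt0r_neq0 (rho0 n)) implybT.
  (* The expansion is available on the open interval only; points tending to the interior point [t0]
     eventually enter it. *)
  have t_in : 0 < t0 + rho n * (s - s_ n) < 1.
    by apply/andP; split; near: n; [exact: (cvgr_gt _ tc)|exact: (cvgr_lt _ tc)].
  have := gp _ t_in; rewrite (addrAC t0) subrr add0r subrK => /le_trans; apply.
  apply: (le_trans (ler_wpM2r (powR_ge0 _ _) (ler_norm C))).
  rewrite ler_wpM2l //; apply: ge0_ler_powR; rewrite ?nnegrE //; [exact: ltW|exact: ltW|].
  by rewrite normrM gtr0_norm // ler_piMr // ltW.
have -> : (fun n => (g (t0 + rho n * (s - s_ n)) - g t0) / rho n ^+ k) =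
    (fun n => (g (t0 + rho n * (s - s_ n)) - p.[rho n * (s - s_ n)]) / rho n ^+ k
              + (s - s_ n) ^+ k * q.[rho n * (s - s_ n)]).
  apply/funext => n; rewrite gt0 [in RHS]pE exprMn.
  by field; rewrite expf_neq0 // gt_eqF.
have -> : p`_k * (s - x) ^+ k = 0 + (s - x) ^+ k * q.[0].
  by rewrite add0r horner_coef0 coef_drop_poly add0n mulrC.
exact: cvgD rest main.
Unshelve. all: end_near. Qed.

(** * The self-affine function with equal pieces and zero signature *)

Lemma self_affine_similarity (R : realType) (d m : nat)
    (eps : 'I_m -> bool) (c : 'I_m -> R)
    (S : 'I_m -> 'rV[R]_d -> 'rV[R]_d) (f : R -> 'rV[R]_d) :
  self_affine_function eps c S f ->
  (forall i, c i = m%:R^-1) -> (forall i, eps i = false) ->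
  forall (i : 'I_m) (s : R), 0 <= s <= 1 ->
    f ((i%:R + s) / m%:R) = S i (f s).
Proof.
move=> [_ hf] hc heps i s s01.
have m0 : (m%:R : R) != 0.
  by rewrite pnatr_eq0; case: m i {eps c S hf hc heps} => // -[].
have si : sigma eps c i = i%:R / m%:R.
  rewrite /sigma heps mul0r addr0 (eq_bigr (fun=> m%:R^-1)) => [|j _ //].
  rewrite -(big_ord_widen m (fun=> m%:R^-1) (ltnW (ltn_ord i))).
  by rewrite sumr_const card_ord mulr_natl.
have e : phi eps c i s = (i%:R + s) / m%:R.
  by rewrite /phi si heps hc expr0 mul1r; field.
rewrite -e (hf i); last by exists s; rewrite //= in_itv.
by rewrite phiK // hc invr_gt0 lt0r m0 ler0n.
Qed.

(** The endpoint values are fixed points of the first and last maps, and so are [pta] and [ptb].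
    This normalization later identifies the constant [K]. *)
Lemma self_affine_increment01 (R : realType) (d m : nat)
    (eps : 'I_m -> bool) (lam c : 'I_m -> R)
    (S : 'I_m -> 'rV[R]_d -> 'rV[R]_d) (f : R -> 'rV[R]_d) :
  self_affine_system eps lam c S -> self_affine_function eps c S f ->
  (forall i, c i = m%:R^-1) -> (forall i, eps i = false) ->
  enorm (f 1 - f 0) = 1.
Proof.
move=> hS hf hc heps.
have sim := self_affine_similarity hf hc heps.
have m2 := sas_size hS.
have m0 : (0 < m)%N by apply: leq_trans m2.
have pm : (m.-1 < m)%N by rewrite prednK.
have mr0 : (m%:R : R) != 0 by rewrite pnatr_eq0 -lt0n.
have f0 : f 0 = pta R d.
  apply: (similitude_fixpoint_unique (sas_sim hS (Ordinal m0))).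
    by rewrite -sim ?lexx ?ler01 //= addr0 mul0r.
  by rewrite -[RHS](sas_first hS (i := Ordinal m0)) // /first_pt heps /= subr0
    scale1r scale0r addr0.
have f1 : f 1 = ptb R d.
  apply: (similitude_fixpoint_unique (sas_sim hS (Ordinal pm))).
    by rewrite -sim ?lexx ?ler01 //= natr1 prednK // divff.
  rewrite -[RHS](sas_last hS (i := Ordinal pm)) /= ?prednK //.
  by rewrite /last_pt heps /= subr0 scale1r scale0r add0r.
by rewrite f0 f1 subr0 enorm_ptb // (sas_dim hS).
Qed.

(** * Comparison of [f] with a monomial *)

(** Increments over m-adic intervals shrinking to [t0] are computed both by self-similarity and by
    the expansion. Squared norms are sums over coordinates, so limits can be taken
    coordinatewise. *)
Lemma monomial_increment_of_expansion (R : realType) (d m : nat)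
    (lam : 'I_m -> R) (f : R -> 'rV[R]_d) (P : 'I_d -> {poly R})
    (alpha C t0 : R) (k : nat) :
  (1 < m)%N ->
  (forall (i : 'I_m) (s s' : R), 0 <= s <= 1 -> 0 <= s' <= 1 ->
    enorm (f ((i%:R + s) / m%:R) - f ((i%:R + s') / m%:R)) =
    lam i * enorm (f s - f s')) ->
  enorm (f 1 - f 0) = 1 ->
  0 < t0 < 1 -> (0 < k)%N -> k%:R < alpha ->
  (forall t, 0 < t < 1 ->
    enorm (f t - poly_row P (t - t0)) <= C * `|t - t0| `^ alpha) ->
  (forall j i, (0 < i < k)%N -> (P j)`_i = 0) ->
  exists2 x, 0 <= x <= 1 &
    exists K, forall s s', 0 <= s <= 1 -> 0 <= s' <= 1 ->
      K * enorm (f s - f s') ^+ 2 =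
      (\sum_j (P j)`_k ^+ 2) * ((s - x) ^+ k - (s' - x) ^+ k) ^+ 2.
Proof.
move=> m1 sim f01 t01 k0 ka fP Pk.
have m0 : (0 < m)%N by apply: ltnW.
have mr0 : (0 : R) < m%:R by rewrite ltr0n.
have t01' : 0 <= t0 <= 1 by case/andP: t01 => *; rewrite !ltW.
have [sL zoom] := choice (fun n => zoom_similarity m0 sim n t01').
(* The relative positions of [t0] lie in the unit interval, so some subsequence converges. *)
have [u ui /cvg_ex[/= x ux]] : exists2 u : nat -> nat, increasing_seq u &
    cvgn ((fun n => (sL n).1) \o u).
  apply: bolzano_weierstrass; exists 1; split=> // M M1 n _.
  have [/andP[a b] _] := zoom n.
  by rewrite /= ger0_norm // (le_trans b) // ltW.
have x01 : 0 <= x <= 1.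
  apply/andP; split; [apply: cvgr_to_ge ux _|apply: cvgr_to_le ux _].
    by apply: nearW => n; have [/andP[]] := zoom (u n).
  by apply: nearW => n; have [/andP[]] := zoom (u n).
exists x => //.
pose rho n : R := m%:R^-1 ^+ u n.
have rho0 n : 0 < rho n by rewrite exprn_gt0 // invr_gt0.
have rhoc : rho @ \oo --> 0.
  have un n : (n <= u n)%N.
    elim: n => // n /leq_ltn_trans; apply.
    by move/increasing_seqP : ui; exact.
  have uoo : u @ \oo --> \oo.
    apply/cvgnyPge => A; near=> n.
    by rewrite (leq_trans _ (un n)) //; near: n; exact: nbhs_infty_ge.
  have r1 : `|m%:R^-1| < 1 :> R.
    by rewrite gtr0_norm ?invr_gt0 // invf_lt1 // ltr1n.
  exact: (cvg_comp _ _ uoo (cvg_expr r1)).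
pose w s n : 'rV[R]_d := f (t0 + rho n * (s - (sL (u n)).1)).
have coord s s' j : 0 <= s <= 1 -> 0 <= s' <= 1 ->
    ((w s n 0 j - w s' n 0 j) / rho n ^+ k) ^+ 2 @[n --> \oo]
      --> ((P j)`_k * ((s - x) ^+ k - (s' - x) ^+ k)) ^+ 2.
  (* Both points are compared with [t0], whose value cancels in the difference. *)
  have lim z : 0 <= z <= 1 ->
      (w z n 0 j - f t0 0 j) / rho n ^+ k @[n --> \oo]
        --> (P j)`_k * (z - x) ^+ k.
    move=> z01.
    apply: (@rescaled_increment_cvg _ (fun t => f t 0 j) _ alpha C t0 x z k rho
      (fun n => (sL (u n)).1)) => //.
    - move=> t /fP; apply: le_trans.
      have := norm_coord_le_enorm (f t - poly_row P (t - t0)) j.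
      by rewrite !mxE.
    - by move=> i ik; exact: Pk.
    - move=> n; have [+ _] := zoom (u n).
      case/andP: z01 => z0 z1 /andP[a b].
      by rewrite ler_norml; apply/andP; split; lra.
  move=> s01 s'01.
  rewrite mulrBr.
  have -> : (fun n => ((w s n 0 j - w s' n 0 j) / rho n ^+ k) ^+ 2) =
      (fun n => ((w s n 0 j - f t0 0 j) / rho n ^+ k
                 - (w s' n 0 j - f t0 0 j) / rho n ^+ k) ^+ 2).
    by apply/funext => n; rewrite -mulrBl; congr ((_ / _) ^+ _); ring.
  exact: (cvg_comp _ _ (cvgB (lim _ s01) (lim _ s'01)) (@exprn_continuous R 2 _)).
have sumE s s' : 0 <= s <= 1 -> 0 <= s' <= 1 ->
    ((sL (u n)).2 / rho n ^+ k) ^+ 2 * enorm (f s - f s') ^+ 2 @[n --> \oo]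
    --> (\sum_j (P j)`_k ^+ 2) * ((s - x) ^+ k - (s' - x) ^+ k) ^+ 2.
  move=> s01 s'01.
  rewrite mulr_suml.
  have -> : (fun n => ((sL (u n)).2 / rho n ^+ k) ^+ 2 * enorm (f s - f s') ^+ 2) =
     (fun n => \sum_j ((w s n 0 j - w s' n 0 j) / rho n ^+ k) ^+ 2).
    apply/funext => n; have [_ z] := zoom (u n).
    rewrite -exprMn mulrAC -z // exprMn sqr_enorm mulr_suml.
    by apply: eq_bigr => j _; rewrite exprMn !mxE.
  under eq_bigr do rewrite -exprMn.
  by apply: cvg_big => // [|j _]; [exact: add_continuous|exact: coord].
(* As [f 1 - f 0] has norm 1, the case [s = 1], [s' = 0] shows that this is the limit of the squared
   scaling factors. *)
exists ((\sum_j (P j)`_k ^+ 2) * ((1 - x) ^+ k - (0 - x) ^+ k) ^+ 2) => s s' s01 s'01.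
have i1 : 0 <= (1 : R) <= 1 by rewrite ler01 lexx.
have i0 : 0 <= (0 : R) <= 1 by rewrite ler01 lexx.
have := sumE _ _ i1 i0; rewrite f01 expr1n; under eq_fun do rewrite mulr1.
move=> lim.
have lim' := cvgM lim (cvg_cst (enorm (f s - f s') ^+ 2)).
apply: cvg_unique (sumE _ _ s01 s'01); first exact: norm_hausdorff.
exact: lim'.
Unshelve. all: end_near. Qed.

(** * Equality of the two exponents *)

Theorem theorem2p5 (R : realType) (d m : nat)
    (eps : 'I_m -> bool) (lam c : 'I_m -> R)
    (S : 'I_m -> 'rV[R]_d -> 'rV[R]_d) (f : R -> 'rV[R]_d)
    (hS : self_affine_system eps lam c S)
    (hf : self_affine_function eps c S f)
    (hc : forall i, c i = m%:R^-1)
    (heps : forall i, eps i = false) :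
  forall t : R, 0 < t < 1 ->
    hoelder_exponent f t = nondir_hoelder_exponent f t.
Proof.
move=> t0 t01; rewrite /hoelder_exponent /nondir_hoelder_exponent.
(* The two sets of admissible [alpha] already coincide. *)
congr (ereal_sup (EFin @` _)); apply/seteqP; split=> alpha /= [a0 hC]; split=> //.
  case: hC => C [P [degP fP]].
  have ft0 : f t0 = poly_row P 0.
    apply/eqP; rewrite -subr_eq0; apply/eqP/enorm0_eq0/le_anti.
    rewrite enorm_ge0 andbT; have := fP t0 t01.
    by rewrite subrr normr0 powR0 ?gt_eqF // mulr0.
  have [Pcst|] := pselect (forall j k, (0 < k)%N -> (P j)`_k = 0).
    exists C => t /fP; congr (enorm (f t - _) <= _); rewrite ft0.
    apply/rowP => j; rewrite !mxE.
    have -> : P j = ((P j)`_0)%:P.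
      by apply/polyP => -[|i]; rewrite coefC //= Pcst.
    by rewrite !hornerC.
  move=> nPcst.
  (* The least such [k] is taken over all coordinates at once, so lower nonconstant terms vanish in
     every [P j]. *)
  pose bad k := (0 < k)%N && [exists j, (P j)`_k != 0].
  have exbad : exists k, bad k.
    apply: contrapT => nbad; apply: nPcst => j k k0; apply/eqP.
    apply: contrapT => /negP Pjk; apply: nbad; exists k; rewrite /bad k0 /=.
    by apply/existsP; exists j.
  case: (ex_minnP exbad) => k /andP[k0 /existsP[j Pjk]] kmin.
  have ka : k%:R < alpha.
    apply: le_lt_trans (degP j); rewrite ler_nat.
    have : (k < size (P j))%N.
      by rewrite ltnNge; apply: contra Pjk => /leq_sizeP ->.
    by case: size.
  have Pk j' i : (0 < i < k)%N -> (P j')`_i = 0.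
    case/andP=> i0 ik; apply/eqP; apply: contraLR ik => Pji; rewrite -leqNgt.
    by apply: kmin; rewrite /bad i0; apply/existsP; exists j'.
  have m1 := sas_size hS.
  have sim (i : 'I_m) (s s' : R) : 0 <= s <= 1 -> 0 <= s' <= 1 ->
      enorm (f ((i%:R + s) / m%:R) - f ((i%:R + s') / m%:R)) =
      lam i * enorm (f s - f s').
    move=> s01 s'01; rewrite !(self_affine_similarity hf hc heps) //.
    by have [_ ->] := sas_sim hS i.
  have [x x01 [K fK]] := monomial_increment_of_expansion m1 sim
    (self_affine_increment01 hS hf hc heps) t01 k0 ka fP Pk.
  have A0 : \sum_j (P j)`_k ^+ 2 != 0.
    rewrite psumr_neq0 => [|i _]; last exact: sqr_ge0.
    by apply/hasP; exists j; rewrite ?mem_index_enum //= lt0r sqrf_eq0 Pjk sqr_ge0.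
  case: (sas_neq hS) => i; rewrite hc.
  apply: (power_similitude_ratio m1 k0 _ x01) => [i'|i' s s' s01 s'01].
    by have [/andP[]] := sas_sim hS i'.
  (* Multiplied by the nonzero sum of squares, both sides become [K] times squared increments of
     [f], which scale by [lam i' ^+ 2] on the piece [i']. *)
  apply: (mulfI A0).
  rewrite -fK ?branch_unit_interval // sim // exprMn mulrCA fK //.
  exact: mulrCA.
case: hC => C fC.
(* Conversely, the constant value at [t0] is an expansion of degree 0, below any positive
   [alpha]. *)
exists C, (fun j => (f t0 0 j)%:P); split=> [j|t /fC].
  by apply: le_lt_trans a0; rewrite size_polyC; case: eqP.
congr (enorm (f t - _) <= _); apply/rowP => j.
by rewrite !mxE hornerC.
Qed.
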